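(* Let $G_1$ be an $r_1$-regular graph with $n_1$ vertices and $m_1$ edges and let $G_2$ be an arbitrary graph with $n_2$ vertices. Then the Laplacian characteristic polynomial of the central vertex corona $G_1\odot G_2$ is (as an identity of rational functions in $x$) $$\begin{aligned}f(L(G_1\odot G_2),x)=\;&(x-2)^{m_1-n_1}\Big[x^3-x^2(n_2+r_1+3)+x(r_1+2n_2+2)\Big]\prod_{j=2}^{n_2}\big(x-1-\mu_j(G_2)\big)^{n_1}\\&\times\prod_{i=2}^{n_1}\Big[x^3-x^2\big(n_1+n_2+3+\lambda_i(G_1)\big)+x\big(2n_2+3n_1+2\lambda_i(G_1)+2-r_1\big)-2n_1+r_1-\lambda_i(G_1)\Big].\end{aligned}$$
   Context: All graphs are finite, simple and connected. For a graph $G$ on $n$ vertices, $A(G)$ is its adjacency matrix with eigenvalues $\lambda_1(G)\ge\dots\ge\lambda_n(G)$; $D(G)$ is the diagonal matrix of vertex degrees; $L(G)=D(G)-A(G)$ is the Laplacian matrix with eigenvalues $0=\mu_1(G)<\mu_2(G)\le\dots\le\mu_n(G)$. For an $n\times n$ matrix $M$, $f(M,x)=\det(xI_n-M)$. The central graph $C(G)$ of $G$ is obtained from $G$ by subdividing each edge of $G$ exactly once and joining all pairs of distinct vertices of $G$ that are nonadjacent in $G$. The central vertex corona $G_1\odot G_2$ is obtained by taking one copy of $C(G_1)$ and $|V(G_1)|$ copies of $G_2$, and joining the vertex $v_i$ of $G_1$ (viewed in $C(G_1)$) to every vertex in the $i$-th copy of $G_2$, for each $i$. *)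

(* Defs.v *)
From HB Require Import structures.
From mathcomp Require Import all_boot all_order all_algebra.
From mathcomp Require Import polyrcf.

Set Implicit Arguments.
Unset Strict Implicit.
Unset Printing Implicit Defensive.

Import Order.TTheory GRing.Theory Num.Theory.

Local Open Scope ring_scope.

Record sgraph := SGraph {
  vertex :> finType;
  adj : rel vertex;
  adj_sym : symmetric adj;
  adj_irr : irreflexive adj }.

(* The graph with no vertices is not connected. *)
Definition connected (G : sgraph) : Prop :=
  (0 < #|G|)%N /\ forall u v : G, connect (@adj G) u v.

Definition degree (G : sgraph) (v : G) : nat := #|[set w | adj v w]|.

Definition regular (G : sgraph) (r : nat) : Prop :=
  forall v : G, degree v = r.

Definition edge_set (G : sgraph) : {set {set G}} :=
  [set [set p.1; p.2] | p : G * G & adj p.1 p.2].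

Definition edge (G : sgraph) : finType := {E : {set G} | E \in edge_set G}.

(* The vertex inr E subdivides the edge E. *)
Definition central_adj (G : sgraph) : rel (G + edge G) := fun a b =>
  match a, b with
  | inl u, inl v => (u != v) && ~~ adj u v
  | inl u, inr E => u \in val E
  | inr E, inl u => u \in val E
  | inr _, inr _ => false
  end.

Lemma central_adj_sym (G : sgraph) : symmetric (@central_adj G).
Proof. by move=> [u|E] [v|F] //=; rewrite eq_sym adj_sym. Qed.

Lemma central_adj_irr (G : sgraph) : irreflexive (@central_adj G).
Proof. by move=> [u|E] //=; rewrite eqxx. Qed.

Definition central_graph (G : sgraph) : sgraph :=
  SGraph (@central_adj_sym G) (@central_adj_irr G).

(* The vertices inr (u, x), for x in G2, form the copy of G2 attached to u. *)
Definition corona_adj (G1 G2 : sgraph) : rel (central_graph G1 + G1 * G2) :=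
  fun a b =>
  match a, b with
  | inl c, inl d => adj c d
  | inl c, inr (u, _) => c == inl u
  | inr (u, _), inl c => c == inl u
  | inr (u, x), inr (v, y) => (u == v) && adj x y
  end.

Lemma corona_adj_sym (G1 G2 : sgraph) : symmetric (@corona_adj G1 G2).
Proof.
move=> [c|[u x]] [d|[v y]] //=; first exact: central_adj_sym.
by rewrite eq_sym adj_sym.
Qed.

Lemma corona_adj_irr (G1 G2 : sgraph) : irreflexive (@corona_adj G1 G2).
Proof.
move=> [c|[u x]] /=; first exact: central_adj_irr.
by rewrite adj_irr andbF.
Qed.

Definition central_vertex_corona (G1 G2 : sgraph) : sgraph :=
  SGraph (@corona_adj_sym G1 G2) (@corona_adj_irr G1 G2).

Section Spectra.
Variable R : rcfType.

(* Rows and columns follow the enumeration of the vertex type. *)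
Definition adjmx (G : sgraph) : 'M[R]_#|G| :=
  \matrix_(i, j) (adj (enum_val i) (enum_val j))%:R.

Definition degmx (G : sgraph) : 'M[R]_#|G| :=
  diag_mx (\row_i (degree (enum_val i))%:R).

Definition lapmx (G : sgraph) : 'M[R]_#|G| := degmx G - adjmx G.

(* The eigenvalues of M that lie in R, in nondecreasing order and repeated
   according to algebraic multiplicity; for a symmetric M these are all its
   eigenvalues. *)
Definition spectrum n (M : 'M[R]_n) : seq R :=
  flatten [seq nseq (mup x (char_poly M)) x | x <- rootsR (char_poly M)].

(* Indices start at 1: adj_eig G 1 is the largest adjacency eigenvalue and
   lap_eig G 1 the smallest Laplacian eigenvalue. *)
Definition adj_eig (G : sgraph) (i : nat) : R :=
  nth 0 (rev (spectrum (adjmx G))) i.-1.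

Definition lap_eig (G : sgraph) (j : nat) : R :=
  nth 0 (spectrum (lapmx G)) j.-1.

End Spectra.

(* The library keeps its notation for tofrac local. *)
Notation "p %:F" := (@tofrac _ p) : ring_scope.

(* Main.v *)
Require Import Defs.
From mathcomp Require Import all_boot all_order all_algebra.
From mathcomp Require Import complex polyrcf perm ring.

Import Order.TTheory GRing.Theory Num.Theory.
Local Open Scope ring_scope.

Set Implicit Arguments.
Unset Strict Implicit.
Unset Printing Implicit Defensive.

(** Write [C] for the corona, [L2] for the Laplacian of [G2], [A] and [B] for
    the adjacency and the vertex-edge incidence matrices of [G1], and [J] for
    the all-ones matrix.  In [x - L(C)] the edges of [G1] and the copies of [G2] do
    not interact, so that two successive Schur complements compute its determinant.

    The copies of [G2] contribute [det ((x - 1) - L2) ^ n1]; as [L2] kills the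
    all-ones vector, the system to be solved for the Schur complement has an
    explicit solution, equal to [1 / (x - 1)] on the copy attached to the vertex
    at hand and to [0] elsewhere, so that eliminating the copies only subtracts
    [n2 / (x - 1)] on the diagonal of the vertices of [G1].  The edges contribute [(x - 2) ^ m1], and eliminating them subtracts
    [B B^T / (x - 2) = (r1 + A) / (x - 2)].  There remains the determinant of
    [a - b A + J] with [a = x - n1 - n2 - n2 / (x - 1) - r1 / (x - 2)] and
    [b = 1 + 1 / (x - 2)] ([fdet_corona]).

    As [G1] is regular, [a - b A] has constant row sums [a - b r1], whence
    [det (a - b A + J) = det (a - b A) (1 + n1 / (a - b r1))] ([fdet_add1]):
    the factor of the eigenvalue [r1] is replaced by [a - b r1 + n1].
    Multiplying each of the [n1] factors by [(x - 1) (x - 2)] turns it into a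
    cubic of the statement.

    For the indexing of the eigenvalues, a real symmetric matrix has a split
    characteristic polynomial, so [spectrum] lists all its roots
    with multiplicity ([prod_spectrum]).  The all-ones vector has eigenvalue
    [r1] for [A] and [0] for [L2], and Gershgorin's theorem shows that these are
    the largest adjacency eigenvalue of [G1] and the smallest Laplacian
    eigenvalue of [G2].  The computation is made in any field extension [K] of [R], at a
    point [x] that is transcendental over [R]; the theorem is the case of the
    indeterminate in the field of fractions of [{poly R}]. *)

(** * Characteristic polynomials of symmetric matrices *)

Lemma horner_char_poly (K : comNzRingType) n (A : 'M[K]_n) (t : K) :
  (char_poly A).[t] = \det (t%:M - A).
Proof.
rewrite -horner_evalE -det_map_mx; congr (\det _); apply/matrixP=> i j.
by rewrite !mxE /= /horner_eval hornerD hornerN hornerMn hornerX hornerC.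
Qed.

Lemma char_poly_similar (K : fieldType) n (P D : 'M[K]_n) :
  P \in unitmx -> char_poly (invmx P *m D *m P) = char_poly D.
Proof.
move=> Pu; pose f := map_mx (@polyC K).
have fVK : f n n (invmx P) *m f n n P = 1%:M by rewrite -map_mxM mulVmx // map_mx1.
rewrite /char_poly.
have -> : char_poly_mx (invmx P *m D *m P)
    = f n n (invmx P) *m char_poly_mx D *m f n n P.
  rewrite /char_poly_mx mulmxBr mulmxBl -!map_mxM; congr (_ - _).
  by rewrite scalar_mxC -mulmxA fVK mulmx1.
by rewrite !det_mulmx mulrAC -det_mulmx fVK det1 mul1r.
Qed.

(** Over [R[i]] the matrix is Hermitian, hence unitarily diagonalizable with
    real eigenvalues. *)
Lemma char_poly_symmetric_split (R : rcfType) n (A : 'M[R]_n) :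
  A^T = A -> exists s : seq R, char_poly A = \prod_(x <- s) ('X - x%:P).
Proof.
move=> symA; pose B : 'M[R[i]]_n := map_mx (real_complex R) A.
have hermB : B \is hermsymmx.
  apply: realsym_hermsym.
    by apply/is_hermitianmxP; rewrite expr0 scale1r map_mx_id // map_trmx symA.
  by apply/mxOverP=> i j; rewrite mxE; apply/complex_realP; exists (A i j).
have /mxOverP realD := hermitian_spectral_diag_real hermB.
have /hermitian_normalmx/orthomx_spectralP := hermB.
set P := spectralmx B; set d := spectral_diag B => defB.
exists [seq complex.Re (d 0 i) | i <- index_enum 'I_n].
apply: (map_poly_inj (real_complex R)); rewrite map_char_poly -/B {1}defB.
rewrite char_poly_similar ?spectral_unit // char_poly_trig ?diag_mx_is_trig //.
rewrite big_map rmorph_prod; apply: eq_bigr => i _ /=.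
by rewrite rmorphB /= map_polyX map_polyC /= RRe_real // mxE eqxx.
Qed.

Section Spectrum.
Variables (R : rcfType) (n : nat) (A : 'M[R]_n).
Hypothesis symA : A^T = A.

Lemma prod_spectrum : \prod_(x <- spectrum A) ('X - x%:P) = char_poly A.
Proof.
have [s defA] := char_poly_symmetric_split symA.
have A0 : char_poly A != 0 by rewrite monic_neq0 // char_poly_monic.
rewrite [in RHS]defA; apply: perm_big; apply/allP => x _ /=; apply/eqP.
rewrite /spectrum count_flatten -map_comp.
rewrite (eq_map (g := fun y => (y == x) * mup y (char_poly A)))%N; last first.
  by move=> y /=; rewrite count_nseq.
rewrite sumnE big_map -mu_prod_XsubC -defA.
have uS : uniq (rootsR (char_poly A)) by rewrite uniq_roots.
have [xS|xNS] := boolP (x \in rootsR (char_poly A)).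
  rewrite (bigD1_seq x) //= eqxx mul1n big1 ?addn0 // => y /negPf -> //.
rewrite big1_seq => [|y /= yS]; last first.
  by case: eqP xNS => [<-|//]; rewrite yS.
by rewrite mupNroot //; apply: contra xNS => rx; rewrite -roots_on_rootsR ?rx.
Qed.

Lemma spectrum_sorted : sorted <=%R (spectrum A).
Proof.
rewrite /spectrum; have := sorted_roots (- cauchy_bound (char_poly A))
  (cauchy_bound (char_poly A)) (char_poly A); rewrite -/(rootsR _).
rewrite (sorted_pairwise lt_trans) (sorted_pairwise le_trans).
elim: (rootsR _) => //= x s IHs /andP[xs {}/IHs IHs].
rewrite pairwise_cat IHs andbT; apply/andP; split; last first.
  by elim: (mup x _) => //= k ->; rewrite andbT; elim: k => //= k ->; rewrite lexx.
apply/allrelP => y z /nseqP[-> _] /flatten_mapP[t ts /nseqP[-> _]].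
by rewrite ltW // (allP xs).
Qed.

Lemma size_spectrum : size (spectrum A) = n.
Proof.
apply: succn_inj; rewrite -(size_char_poly A) -prod_spectrum.
by rewrite size_prod_XsubC.
Qed.

Lemma mem_spectrum x : (x \in spectrum A) = root (char_poly A) x.
Proof. by rewrite -prod_spectrum root_prod_XsubC. Qed.
End Spectrum.

(** Gershgorin's theorem, by columns: the eigenvectors here are row vectors. *)
Lemma gershgorin (R : realFieldType) n (A : 'M[R]_n) (c : R) :
  root (char_poly A) c ->
  exists i, `|A i i - c| <= \sum_(j | j != i) `|A j i|.
Proof.
rewrite -eigenvalue_root_char => /eigenvalueP[v vA /rV0Pn[i0 vi0]].
pose i := [arg max_(i > i0) `|v 0 i|]%O.
have maxi j : `|v 0 j| <= `|v 0 i|.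
  by rewrite /i; case: Order.TotalTheory.arg_maxP => // k _; apply.
have vi_gt0 : 0 < `|v 0 i| by rewrite (lt_le_trans _ (maxi i0)) ?normr_gt0.
exists i; rewrite -(ler_pM2l vi_gt0) -normrM.
have -> : v 0 i * (A i i - c) = - \sum_(j | j != i) v 0 j * A j i.
  have /rowP/(_ i) := vA; rewrite !mxE (bigD1 i) //= => vAi.
  by rewrite mulrBr [v 0 i * c]mulrC -vAi opprD addrA subrr add0r.
rewrite normrN (le_trans (ler_norm_sum _ _ _)) // mulr_sumr.
by apply: ler_sum => j _; rewrite normrM ler_wpM2r.
Qed.

Lemma root_char_poly_col_sum (F : fieldType) n (A : 'M[F]_n) (c : F) :
  (0 < n)%N -> (forall j, \sum_i A i j = c) -> root (char_poly A) c.
Proof.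
move=> n_gt0 sumA; rewrite -eigenvalue_root_char; apply/eigenvalueP.
exists (const_mx 1).
  apply/rowP=> j; rewrite !mxE mulr1 -(sumA j).
  by apply: eq_bigr => i _; rewrite mxE mul1r.
by apply/rV0Pn; exists (Ordinal n_gt0); rewrite mxE oner_eq0.
Qed.

(** Eigenvalues are numbered from 1, so the tail of [s] is indexed from 2. *)
Lemma cons_nth_iota (T : Type) (x0 c : T) (s : seq T) n :
  size s = n -> (0 < n)%N -> nth x0 s 0 = c ->
  s = c :: [seq nth x0 s j.-1 | j <- index_iota 2 n.+1].
Proof.
case: s => [<-//|x s] /= <- _ ->; congr cons.
rewrite /index_iota !subSS subn0 -[2%N]addn0 iotaDl -map_comp.
by rewrite -[LHS](mkseq_nth x0).
Qed.

(** * Extreme eigenvalues of graphs *)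

Lemma sum_enum_val (V : nmodType) (T : finType) (F : T -> V) :
  \sum_(i < #|T|) F (enum_val i) = \sum_u F u.
Proof. by rewrite [RHS](reindex _ (onW_bij _ (enum_val_bij T))). Qed.

Section GraphSpectra.
Variables (R : rcfType) (G : sgraph).

Lemma degree_sum (K : pzSemiRingType) (u : G) :
  (degree u)%:R = \sum_v (adj u v)%:R :> K.
Proof.
rewrite /degree -sum1_card natr_sum big_mkcond /=.
by apply: eq_bigr => v _; rewrite inE; case: adj.
Qed.

Lemma tr_adjmx : (adjmx R G)^T = adjmx R G.
Proof. by apply/matrixP=> i j; rewrite !mxE adj_sym. Qed.

Lemma tr_lapmx : (lapmx R G)^T = lapmx R G.
Proof. by rewrite /lapmx linearB /= tr_adjmx tr_diag_mx. Qed.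

Lemma col_sum_adjmx j : \sum_i adjmx R G i j = (degree (enum_val j))%:R.
Proof.
rewrite degree_sum -[RHS]sum_enum_val.
by apply: eq_bigr => i _; rewrite mxE adj_sym.
Qed.

Lemma col_sum_lapmx j : \sum_i lapmx R G i j = 0.
Proof.
transitivity (\sum_i degmx R G i j - \sum_i adjmx R G i j).
  by rewrite -sumrB; apply: eq_bigr => i _; rewrite !mxE.
rewrite col_sum_adjmx (bigD1 j) //= big1 ?addr0 => [|i /negPf ij].
  by rewrite !mxE eqxx subrr.
by rewrite !mxE ij.
Qed.

Lemma root_lapmx_ge0 c : root (char_poly (lapmx R G)) c -> 0 <= c.
Proof.
move=> rc; case: (gershgorin rc) => i; rewrite ler_norml => /andP[_].
have -> : lapmx R G i i = (degree (enum_val i))%:R.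
  by rewrite !mxE eqxx adj_irr subr0.
have -> : \sum_(j | j != i) `|lapmx R G j i| = (degree (enum_val i))%:R.
  rewrite -col_sum_adjmx [RHS](bigD1 i) //= mxE adj_irr add0r.
  apply: eq_bigr => j /negPf ji.
  by rewrite !mxE ji sub0r normrN ger0_norm ?ler0n.
by rewrite gerBl.
Qed.

Lemma root_adjmx_le_regular r c :
  regular G r -> root (char_poly (adjmx R G)) c -> c <= r%:R.
Proof.
move=> regG rc; case: (gershgorin rc) => i; rewrite distrC mxE adj_irr subr0.
have -> : \sum_(j | j != i) `|adjmx R G j i| = r%:R.
  rewrite -(regG (enum_val i)) -col_sum_adjmx [RHS](bigD1 i) //= mxE adj_irr add0r.
  by apply: eq_bigr => j _; rewrite !mxE ger0_norm ?ler0n.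
exact/le_trans/ler_norm.
Qed.

Lemma spectrum_lapmx : (0 < #|G|)%N ->
  spectrum (lapmx R G) = 0 :: [seq lap_eig R G j | j <- index_iota 2 #|G|.+1].
Proof.
move=> G_gt0; apply: cons_nth_iota => //; first exact: size_spectrum tr_lapmx.
have : 0 \in spectrum (lapmx R G).
  rewrite (mem_spectrum tr_lapmx); apply: root_char_poly_col_sum => // j.
  exact: col_sum_lapmx.
have := spectrum_sorted (lapmx R G).
have := root_lapmx_ge0; move: (mem_spectrum tr_lapmx).
case: (spectrum _) => //= x s mem_s ge0; rewrite (path_sortedE le_trans).
move=> /andP[/allP xs _]; rewrite inE => /predU1P[//|/xs x_le0].
by apply/le_anti; rewrite x_le0 ge0 // -mem_s mem_head.
Qed.

Lemma spectrum_adjmx r : (0 < #|G|)%N -> regular G r ->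
  rev (spectrum (adjmx R G))
    = r%:R :: [seq adj_eig R G i | i <- index_iota 2 #|G|.+1].
Proof.
move=> G_gt0 regG; apply: cons_nth_iota => //.
  by rewrite size_rev (size_spectrum tr_adjmx).
have : r%:R \in rev (spectrum (adjmx R G)).
  rewrite mem_rev (mem_spectrum tr_adjmx).
  by apply: root_char_poly_col_sum => // j; rewrite col_sum_adjmx regG.
have := spectrum_sorted (adjmx R G); rewrite -rev_sorted.
have mem_s x : (x \in rev (spectrum (adjmx R G))) = root (char_poly (adjmx R G)) x.
  by rewrite mem_rev (mem_spectrum tr_adjmx).
case: (rev _) mem_s => //= x s mem_s; rewrite (path_sortedE ge_trans).
move=> /andP[/allP xs _]; rewrite inE => /predU1P[//|/xs x_ge].
by apply/le_anti; rewrite (x_ge : r%:R <= x) /= (root_adjmx_le_regular regG) //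
   -mem_s mem_head.
Qed.
End GraphSpectra.

(** * Determinants indexed by finite types *)

(** The determinant of a square matrix whose rows and columns are indexed by
    an arbitrary finite type, given by its entries.  By [fdet_reindex] it does
    not depend on the enumeration of the type. *)
Definition fdet (K : comNzRingType) (T : finType) (f : T -> T -> K) : K :=
  \det (\matrix_(i < #|T|, j < #|T|) f (enum_val i) (enum_val j)).

Section FDet.
Variable K : comNzRingType.

Lemma eq_fdet (T : finType) (f g : T -> T -> K) : f =2 g -> fdet f = fdet g.
Proof. by move=> fg; congr (\det _); apply/matrixP=> i j; rewrite !mxE fg. Qed.

Lemma fdet_enum (T : finType) (f : T -> T -> K) n (h : 'I_n -> T) :
  bijective h -> fdet f = \det (\matrix_(i, j) f (h i) (h j)).
Proof.
move=> bh; have := bij_eq_card bh; rewrite card_ord => en.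
move: h bh; rewrite en => h [g hK gK].
have s_inj : injective (g \o enum_val (A := T)).
  by apply: inj_comp; [exact: can_inj gK | exact: enum_val_inj].
pose s := perm s_inj; pose M := \matrix_(i, j) f (h i) (h j).
have -> : fdet f = \det (row_perm s (col_perm s M)).
  by congr (\det _); apply/matrixP=> i j; rewrite !mxE !permE /= !gK.
rewrite row_permE col_permE !det_mulmx !det_perm odd_permV mulrCA mulrA -mulrA.
by rewrite -signr_addb addbb mulr1.
Qed.

Lemma fdet_reindex (S T : finType) (h : S -> T) (f : T -> T -> K) :
  bijective h -> fdet f = fdet (fun x y => f (h x) (h y)).
Proof.
move=> bh; apply: (@fdet_enum _ _ _ (h \o enum_val)).
exact: bij_comp bh (enum_val_bij S).
Qed.

(** Schur complement of the lower right block [S].  That block need not be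
    invertible: a solution [z] of [S z = Q], where [Q] is the lower left block,
    suffices. *)
Lemma fdet_schur (A B : finType) (f : A + B -> A + B -> K) (z : B -> A -> K) :
  (forall b a, \sum_b' f (inr b) (inr b') * z b' a = f (inr b) (inl a)) ->
  fdet f = fdet (fun b b' => f (inr b) (inr b'))
    * fdet (fun a a' => f (inl a) (inl a') - \sum_b f (inl a) (inr b) * z b a').
Proof.
move=> fz; pose m := #|A|; pose n := #|B|.
pose h (k : 'I_(m + n)) : A + B :=
  match split k with inl i => inl (enum_val i) | inr j => inr (enum_val j) end.
have bh : bijective h.
  exists (fun c => match c with inl a => lshift n (enum_rank a)
                           | inr b => rshift m (enum_rank b) end).
    by move=> k; rewrite /h; case: split_ordP => i ->; rewrite enum_valK.
  by case=> a; rewrite /h ?(unsplitK (inl _)) ?(unsplitK (inr _)) enum_rankK.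
have hl i : h (lshift n i) = inl (enum_val i).
  by rewrite /h (unsplitK (inl i)).
have hr i : h (rshift m i) = inr (enum_val i).
  by rewrite /h (unsplitK (inr i)).
pose M1 : 'M[K]_m := \matrix_(i, j) f (inl (enum_val i)) (inl (enum_val j)).
pose M2 : 'M[K]_(m, n) := \matrix_(i, j) f (inl (enum_val i)) (inr (enum_val j)).
pose M3 : 'M[K]_(n, m) := \matrix_(i, j) f (inr (enum_val i)) (inl (enum_val j)).
pose M4 : 'M[K]_n := \matrix_(i, j) f (inr (enum_val i)) (inr (enum_val j)).
pose Z : 'M[K]_(n, m) := \matrix_(i, j) z (enum_val i) (enum_val j).
have -> : fdet f = \det (block_mx M1 M2 M3 M4).
  rewrite (fdet_enum f bh); congr (\det _); apply/matrixP=> i j; rewrite mxE.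
  by case: (split_ordP i) => i' ->; case: (split_ordP j) => j' ->;
     rewrite ?(block_mxEul, block_mxEur, block_mxEdl, block_mxEdr) mxE
             ?(hl, hr).
have eM3 : M4 *m Z = M3.
  apply/matrixP=> i j; rewrite !mxE -fz -(sum_enum_val (T := B)).
  by apply: eq_bigr => k _; rewrite !mxE.
have -> : block_mx M1 M2 M3 M4
    = block_mx (M1 - M2 *m Z) M2 0 M4 *m block_mx 1%:M 0 Z 1%:M.
  by rewrite mulmx_block !(mulmx0, mulmx1, mul0mx, add0r) eM3 subrK.
rewrite det_mulmx det_ublock det_lblock !det1 !mulr1 mulrC; congr (_ * \det _).
apply/matrixP=> i j; rewrite !mxE -(sum_enum_val (T := B)); congr (_ - _).
by apply: eq_bigr => k _; rewrite !mxE.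
Qed.

Lemma fdet_scalar (T : finType) (c : K) :
  fdet (fun x y : T => c *+ (x == y)) = c ^+ #|T|.
Proof.
rewrite -det_scalar; congr (\det _); apply/matrixP=> i j.
by rewrite !mxE (inj_eq enum_val_inj).
Qed.

Lemma fdet0 (T : finType) (f : T -> T -> K) : #|T| = 0%N -> fdet f = 1.
Proof. by rewrite /fdet => T0; move: (\matrix_(_, _) _); rewrite T0; exact: det_mx00. Qed.

(** The determinant of the tensor product of the identity with [f]. *)
Lemma fdet_prod_ord n (T : finType) (f : T -> T -> K) :
  fdet (fun p q : 'I_n * T => f p.2 q.2 *+ (p.1 == q.1)) = fdet f ^+ n.
Proof.
elim: n => [|n IHn]; first by rewrite fdet0 // card_prod card_ord.
pose h (c : ('I_n * T) + T) : 'I_n.+1 * T :=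
  match c with inl (i, x) => (lift ord0 i, x) | inr x => (ord0, x) end.
have bh : bijective h.
  exists (fun p => if unlift ord0 p.1 is Some i then inl (i, p.2) else inr p.2).
    by case=> [[i x]|x] /=; rewrite ?liftK ?unlift_none.
  by case=> i x /=; case: unliftP => [j|] ->.
rewrite (fdet_reindex _ bh) (fdet_schur (z := fun _ _ => 0)); last first.
  by move=> b [i x] /=; rewrite big1 // => b' _; rewrite mulr0.
rewrite exprS -IHn; congr (_ * _); apply: eq_fdet => // -[i x] [j y] /=.
by rewrite big1 ?subr0 ?(inj_eq (@lift_inj _ _)) // => b _; rewrite mulr0.
Qed.

Lemma fdet_prod (S T : finType) (f : T -> T -> K) :
  fdet (fun p q : S * T => f p.2 q.2 *+ (p.1 == q.1)) = fdet f ^+ #|S|.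
Proof.
pose h (p : 'I_#|S| * T) : S * T := (enum_val p.1, p.2).
have bh : bijective h.
  exists (fun p => (enum_rank p.1, p.2)) => [[i x]|[i x]];
  by rewrite /h /= ?enum_valK ?enum_rankK.
rewrite (fdet_reindex _ bh) -fdet_prod_ord; apply: eq_fdet => p q.
by rewrite (inj_eq enum_val_inj).
Qed.

Lemma fdet_unit (f : unit -> unit -> K) : fdet f = f tt tt.
Proof.
have bh : bijective (fun _ : 'I_1 => tt).
  by exists (fun _ => ord0) => [i|[]] //; rewrite (ord1 i).
by rewrite (fdet_enum f bh) det_mx11 mxE.
Qed.
End FDet.

(** Adding the all-ones matrix to a matrix with constant row sums. *)
Lemma fdet_add1 (F : fieldType) (T : finType) (f : T -> T -> F) (c : F) :
  c != 0 -> (forall x, \sum_y f x y = c) ->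
  fdet (fun x y => f x y + 1) = fdet f * (1 + #|T|%:R / c).
Proof.
move=> c0 fc.
(* Border f by a row of -1 and a column of 1: eliminating either of the two
   diagonal blocks yields one side of the identity. *)
pose h (a b : unit + T) : F :=
  match a, b with
  | inl _, inl _ => 1 | inl _, inr _ => -1
  | inr _, inl _ => 1 | inr x, inr y => f x y
  end.
have -> : fdet f * (1 + #|T|%:R / c) = fdet h.
  rewrite (@fdet_schur _ _ _ h (fun _ _ => c^-1)); last first.
    by move=> x [] /=; rewrite -mulr_suml fc divff.
  by rewrite fdet_unit /= -mulr_suml sumr_const mulNrn mulNr opprK.
pose swap (a : T + unit) : unit + T :=
  match a with inl x => inr x | inr u => inl u end.
have bswap : bijective swap.
  by exists (fun a => match a with inl u => inr u | inr x => inl x end); case.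
rewrite (fdet_reindex h bswap) (fdet_schur (z := fun _ _ => -1)) /=.
  rewrite fdet_unit mul1r; apply: eq_fdet => x y.
  by rewrite big_const card_unit /= addr0 mulrN1 opprK.
by move=> [] x; rewrite big_const card_unit /= addr0 mul1r.
Qed.

(** * Edges and degrees *)

Lemma sum_mulrb (V : nmodType) (T : finType) (u : T) (F : T -> V) :
  \sum_v F v *+ (u == v) = F u.
Proof.
rewrite (bigD1 u) //= eqxx big1 ?addr0 // => v /negPf uv.
by rewrite eq_sym uv.
Qed.

Lemma sum_prod (V : nmodType) (S T : finType) (F : S * T -> V) :
  \sum_p F p = \sum_x \sum_y F (x, y).
Proof. by rewrite pair_bigA; apply: eq_bigr => -[]. Qed.

Section Incidence.
Variable G : sgraph.

Lemma edges_at (u : G) :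
  [set E in edge_set G | u \in E] = [set [set u; w] | w in [pred w | adj u w]].
Proof.
apply/setP=> E; rewrite inE; apply/andP/imsetP => [[]|[w uw ->]]; last first.
  by rewrite set21; split=> //; apply/imsetP; exists (u, w); rewrite ?inE.
case/imsetP=> -[a b]; rewrite inE /= => ab -> /set2P[->|->].
  by exists b.
by exists a; rewrite ?inE ?[adj b a]adj_sym // setUC.
Qed.

Lemma edge_at_inj (u : G) : {in [pred w | adj u w] &, injective (fun w => [set u; w])}.
Proof.
move=> w w'; rewrite !inE => uw uw' /setP/(_ w'); rewrite !inE eqxx orbT.
by case: eqP uw' => [->|_ _]; [rewrite adj_irr | move=> /eqP].
Qed.

(** The identity [B B^T = D + A], where [B] is the vertex-edge incidence matrix
    and [D] the diagonal matrix of degrees. *)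
Lemma sum_edge_incidence (K : nzSemiRingType) (u v : G) :
  \sum_(E : edge G) (u \in val E)%:R * (v \in val E)%:R
    = (degree u)%:R *+ (u == v) + (adj u v)%:R :> K.
Proof.
transitivity (\sum_(w | adj u w) (v \in [set u; w])%:R : K).
  rewrite -(big_imset (fun E : {set G} => (v \in E)%:R) (@edge_at_inj u)) /=.
  rewrite -edges_at -(big_sub (fun E => E \in edge_set G)
    (fun E => (u \in E)%:R * (v \in E)%:R)) /=.
  rewrite (eq_bigl _ _ (in_set _)) big_mkcondr.
  by apply: eq_bigr => E _; case: (u \in E); rewrite ?mul1r ?mul0r.
have [<-|uv] := eqVneq u v.
  rewrite adj_irr addr0 degree_sum [RHS]big_mkcond /= [LHS]big_mkcond.
  by apply: eq_bigr => w _; rewrite set21; case: adj.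
rewrite add0r -(sum_mulrb v (fun w => (adj u w)%:R)) [LHS]big_mkcond.
apply: eq_bigr => w _; rewrite !inE eq_sym (negPf uv) /=.
by case: adj; case: (v == w).
Qed.

Lemma sum_edge_at (K : nzSemiRingType) (u : G) :
  \sum_(E : edge G) (u \in val E)%:R = (degree u)%:R :> K.
Proof.
transitivity (\sum_(E : edge G) (u \in val E)%:R * (u \in val E)%:R : K).
  by apply: eq_bigr => E _; case: (u \in _); rewrite ?mulr1 ?mulr0.
by rewrite sum_edge_incidence eqxx adj_irr addr0.
Qed.

Lemma card_edge (E : edge G) : #|val E| = 2%N.
Proof.
case: E => E /= /imsetP[[a b]]; rewrite inE /= => ab ->.
by rewrite cards2; case: eqP ab => [->|//]; rewrite adj_irr.
Qed.
End Incidence.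

(** The entries of the Laplacian matrix, indexed by vertices. *)
Definition lapfun (K : pzRingType) (G : sgraph) (u v : G) : K :=
  (degree u)%:R *+ (u == v) - (adj u v)%:R.

Lemma row_sum_lapfun (K : pzRingType) (G : sgraph) (u : G) :
  \sum_v lapfun K u v = 0.
Proof.
by rewrite sumrB (sum_mulrb u (fun=> (degree u)%:R)) -degree_sum subrr.
Qed.

(** The entries of [t - L], for [L] the Laplacian matrix. *)
Definition charfun (K : pzRingType) (G : sgraph) (t : K) (u v : G) : K :=
  t *+ (u == v) - lapfun K u v.

Lemma row_sum_charfun (K : pzRingType) (G : sgraph) (t : K) (u : G) :
  \sum_v charfun t u v = t.
Proof.
by rewrite sumrB row_sum_lapfun subr0 (sum_mulrb u (fun=> t)).
Qed.

(** * Elimination of the copies and of the edges *)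

Section Corona.
Variables (K : fieldType) (G1 G2 : sgraph).
Let C := central_vertex_corona G1 G2.

Lemma big_corona (F : C -> K) :
  \sum_a F a = \sum_u F (inl (inl u)) + \sum_E F (inl (inr E))
    + \sum_u \sum_x F (inr (u, x)).
Proof.
by rewrite big_sumType big_sumType sum_prod.
Qed.

Lemma degree_corona_vertex (u : G1) :
  (@degree C (inl (inl u)))%:R = (#|G1|%:R - 1 + #|G2|%:R) :> K.
Proof.
rewrite degree_sum big_corona /= sum_edge_at; congr (_ + _).
  transitivity (\sum_v (1 - 1 *+ (u == v) - (adj u v)%:R) + (degree u)%:R : K).
    congr (_ + _); apply: eq_bigr => v _.
    have [<-|_] := eqVneq u v; first by rewrite adj_irr subrr subr0.
    by case: adj; rewrite /= subr0 ?subrr ?subr0.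
  by rewrite !sumrB -degree_sum subrK sumr_const (sum_mulrb u (fun=> 1)).
rewrite -(sum_mulrb u (fun=> #|G2|%:R)); apply: eq_bigr => v _.
by rewrite sumr_const mulrnAC.
Qed.

Lemma degree_corona_edge (E : edge G1) :
  (@degree C (inl (inr E)))%:R = 2 :> K.
Proof.
rewrite degree_sum big_corona /= [X in _ + X]big1 ?addr0; last first.
  by move=> u _; rewrite big1.
rewrite [X in _ + X]big1 // addr0 -(card_edge E) -sum1_card natr_sum.
by rewrite [RHS]big_mkcond; apply: eq_bigr => v _; case: (v \in _).
Qed.

Lemma degree_corona_copy (u : G1) (x : G2) :
  (@degree C (inr (u, x)))%:R = 1 + (degree x)%:R :> K.
Proof.
rewrite degree_sum big_corona /=; congr (_ + _).
  rewrite [X in _ + X]big1 // addr0 -[RHS](sum_mulrb u (fun=> 1)).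
  by apply: eq_bigr => v _; rewrite eq_sym.
rewrite degree_sum -[RHS](sum_mulrb u (fun=> \sum_y (adj x y)%:R)).
apply: eq_bigr => v _; rewrite -sumrMnl; apply: eq_bigr => y _.
by case: (u == v).
Qed.

Variables (r : nat) (x : K).
Hypotheses (reg1 : regular G1 r) (x1 : x - 1 != 0) (x2 : x - 2 != 0).

(** After both eliminations, the entries of the remaining matrix on the vertices
    of [G1] are [schur_diag] on the diagonal, minus [schur_adj] times the
    adjacency, plus 1 everywhere. *)
Definition schur_diag : K := x - #|G1|%:R - #|G2|%:R
  - #|G2|%:R / (x - 1) - r%:R / (x - 2).
Definition schur_adj : K := 1 + (x - 2)^-1.

(** The blocks of [x - L(C)]. *)
Lemma charfun_copy (u v : G1) (y z : G2) :
  charfun x (inr (u, y) : C) (inr (v, z))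
    = charfun (x - 1) y z *+ (u == v).
Proof.
rewrite /charfun /lapfun degree_corona_copy /= (inj_eq inr_inj) xpair_eqE.
case: (u == v) => /=; last by rewrite !mulr0n !subr0.
by case: (y == z) => /=; rewrite ?mulr1n ?mulr0n; ring.
Qed.

Lemma charfun_copy_central (c : central_graph G1) (u : G1) (y : G2) :
  charfun x (inr (u, y) : C) (inl c) = (c == inl u)%:R.
Proof. by rewrite /charfun /lapfun /= mulr0n !sub0r opprK. Qed.

Lemma charfun_central_copy (c : central_graph G1) (u : G1) (y : G2) :
  charfun x (inl c : C) (inr (u, y)) = (c == inl u)%:R.
Proof. by rewrite /charfun /lapfun /= mulr0n !sub0r opprK. Qed.

Lemma charfun_edge (E F : edge G1) :
  charfun x (inl (inr E) : C) (inl (inr F)) = (x - 2) *+ (E == F).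
Proof.
rewrite /charfun /lapfun degree_corona_edge /= subr0 (inj_eq inl_inj) (inj_eq inr_inj).
by rewrite -mulrnBl.
Qed.

Lemma charfun_edge_vertex (E : edge G1) (u : G1) :
  charfun x (inl (inr E) : C) (inl (inl u)) = (u \in val E)%:R.
Proof. by rewrite /charfun /lapfun /= mulr0n !sub0r opprK. Qed.

Lemma charfun_vertex_edge (E : edge G1) (u : G1) :
  charfun x (inl (inl u) : C) (inl (inr E)) = (u \in val E)%:R.
Proof. by rewrite /charfun /lapfun /= mulr0n !sub0r opprK. Qed.

Lemma charfun_vertex (u v : G1) :
  charfun x (inl (inl u) : C) (inl (inl v))
    = (x - #|G1|%:R - #|G2|%:R) *+ (u == v) - (adj u v)%:R + 1.
Proof.
rewrite /charfun /lapfun degree_corona_vertex /= !(inj_eq inl_inj).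
have [<-|_] := eqVneq u v; first by rewrite adj_irr /= !mulr1n; ring.
by rewrite !mulr0n; case: adj => /=; ring.
Qed.

Lemma fdet_corona :
  fdet (charfun x (G := C))
  = fdet (charfun (x - 1) (G := G2)) ^+ #|G1| * (x - 2) ^+ #|edge_set G1|
    * fdet (fun u v : G1 => schur_diag *+ (u == v) - schur_adj * (adj u v)%:R + 1).
Proof.
(* Eliminate the copies: the rows of (x - 1) - L2 sum to x - 1. *)
rewrite (@fdet_schur _ _ _ (charfun x (G := C))
  (fun p c => (c == inl p.1)%:R / (x - 1))); last first.
  move=> [u y] c; rewrite charfun_copy_central.
  rewrite sum_prod /=.
  transitivity (\sum_v (c == inl v)%:R *+ (u == v) : K); last exact: sum_mulrb.
  apply: eq_bigr => v _; rewrite -mulr_suml.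
  rewrite (eq_bigr _ (fun z _ => charfun_copy u v y z)) sumrMnl row_sum_charfun.
  by case: (_ == _); rewrite ?mulr0n ?mul0r // !mulr1n mulrCA divff // mulr1.
rewrite -mulrA; congr (_ * _).
  by rewrite -fdet_prod; apply: eq_fdet => -[u y] [v z]; rewrite charfun_copy.
have sum_copies (c d : central_graph G1) :
    \sum_p charfun x (inl c : C) (inr p) * ((d == inl p.1)%:R / (x - 1))
    = if c is inl u then (#|G2|%:R / (x - 1)) *+ (d == inl u) else 0.
  rewrite sum_prod /=.
  transitivity (\sum_v ((#|G2|%:R / (x - 1)) *+ (d == inl v)) *+ (c == inl v) : K).
    apply: eq_bigr => v _.
    rewrite (eq_bigr _ (fun z _ => congr1 (fun t => t * _) (charfun_central_copy c v z))).
    rewrite sumr_const; case: (_ == _); case: (_ == _) => /=;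
    by rewrite ?mulr1n ?mulr0n ?mul0r ?mulr0 ?mul0rn // !mul1r mulr_natl.
  case: c => [u|E]; last by rewrite big1.
  by rewrite -[RHS](sum_mulrb u (fun v => (#|G2|%:R / (x - 1)) *+ (d == inl v))).
(* Eliminate the edges, whose diagonal block is the scalar matrix x - 2. *)
pose g (c d : G1 + edge G1) : K := charfun x (inl c : C) (inl d)
  - (if c is inl u then (#|G2|%:R / (x - 1)) *+ (d == inl u) else 0).
transitivity (fdet g).
  by apply: eq_fdet => c d; rewrite sum_copies.
rewrite (fdet_schur (z := fun (E : edge G1) u => (u \in val E)%:R / (x - 2))).
  congr (_ * _).
    rewrite -card_sig -fdet_scalar; apply: eq_fdet => E F.
    by rewrite /g subr0 charfun_edge.
  apply: eq_fdet => u v; rewrite /g charfun_vertex (inj_eq inl_inj).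
  have -> : \sum_(E : edge G1) g (inl u) (inr E) * ((v \in val E)%:R / (x - 2))
      = (r%:R *+ (u == v) + (adj u v)%:R) / (x - 2).
    rewrite -(reg1 u) -sum_edge_incidence mulr_suml; apply: eq_bigr => E _.
    by rewrite /g mulr0n subr0 charfun_vertex_edge mulrA.
  rewrite /schur_diag /schur_adj [v == u]eq_sym.
  by case: (u == v); rewrite ?mulr1n ?mulr0n; ring.
move=> E u; rewrite /g subr0 charfun_edge_vertex.
transitivity (\sum_(F : edge G1) (u \in val F)%:R *+ (E == F) : K); last exact: sum_mulrb.
apply: eq_bigr => F _; rewrite subr0 charfun_edge.
by case: (_ == _); rewrite ?mulr0n ?mul0r // !mulr1n mulrCA divff // mulr1.
Qed.
End Corona.

(** * The factorization at a transcendental point *)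

Section Evaluation.
Variables (R : rcfType) (K : fieldType) (phi : {rmorphism R -> K}).

Lemma horner_map_prod_XsubC (I : Type) (s : seq I) (F : I -> R) (t : K) :
  (map_poly phi (\prod_(i <- s) ('X - (F i)%:P))).[t]
    = \prod_(i <- s) (t - phi (F i)).
Proof.
rewrite rmorph_prod horner_prod; apply: eq_bigr => i _.
by rewrite rmorphB /= map_polyX map_polyC hornerXsubC.
Qed.

Lemma fdet_charfun (G : sgraph) (t : K) :
  fdet (charfun t (G := G)) = (map_poly phi (char_poly (lapmx R G))).[t].
Proof.
rewrite map_char_poly horner_char_poly; congr (\det _); apply/matrixP=> i j.
rewrite !mxE /charfun /lapfun (inj_eq enum_val_inj) rmorphB rmorphMn !rmorph_nat.
by case: eqP => [->|].
Qed.

Lemma fdet_charfun_eig (G : sgraph) (t : K) : (0 < #|G|)%N ->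
  fdet (charfun t (G := G))
    = t * \prod_(2 <= j < #|G|.+1) (t - phi (lap_eig R G j)).
Proof.
move=> G_gt0; rewrite fdet_charfun -(prod_spectrum (tr_lapmx R G)).
by rewrite horner_map_prod_XsubC spectrum_lapmx // big_cons rmorph0 subr0 big_map.
Qed.

(** The case of a regular graph, with the factor of the largest eigenvalue [r]
    split off. *)
Lemma fdet_adj_eig (G : sgraph) (r : nat) (a b : K) :
  (0 < #|G|)%N -> regular G r -> b != 0 ->
  fdet (fun u v : G => a *+ (u == v) - b * (adj u v)%:R)
    = (a - b * r%:R) * \prod_(2 <= i < #|G|.+1) (a - b * phi (adj_eig R G i)).
Proof.
move=> G_gt0 regG b0; set s := index_iota _ _.
transitivity (\det (b *: ((a / b)%:M - map_mx phi (adjmx R G)))).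
  congr (\det _); apply/matrixP=> i j; rewrite !mxE (inj_eq enum_val_inj).
  by rewrite rmorph_nat; case: (i == j); rewrite ?mulr1n ?mulr0n; field.
rewrite detZ -horner_char_poly -map_char_poly -(prod_spectrum (tr_adjmx R G)).
rewrite horner_map_prod_XsubC -[X in b ^+ X](size_spectrum (tr_adjmx R G)).
rewrite -count_predT -iter_mulr_1 -big_const_seq -big_split /=.
transitivity (\prod_(c <- rev (spectrum (adjmx R G))) (a - b * phi c)).
  rewrite (perm_big _ (permEl (perm_rev _))); apply: eq_bigr => c _.
  by field.
by rewrite (spectrum_adjmx _ G_gt0 regG) big_cons big_map rmorph_nat.
Qed.

Lemma horner_char_poly_corona (G1 G2 : sgraph) (r : nat) (x : K)
    (a := schur_diag G1 G2 r x) (b := schur_adj x) :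
  (0 < #|G1|)%N -> (0 < #|G2|)%N -> regular G1 r ->
  x - 1 != 0 -> x - 2 != 0 -> a - b * r%:R != 0 ->
  (map_poly phi (char_poly (lapmx R (central_vertex_corona G1 G2)))).[x]
    = (x - 2) ^+ #|edge_set G1| * (a - b * r%:R + #|G1|%:R)
      * ((x - 1) * \prod_(2 <= j < #|G2|.+1) (x - 1 - phi (lap_eig R G2 j)))
        ^+ #|G1|
      * \prod_(2 <= i < #|G1|.+1) (a - b * phi (adj_eig R G1 i)).
Proof.
move=> G1_gt0 G2_gt0 regG1 x1 x2 c0.
have b0 : b != 0.
  have -> : b = (x - 1) / (x - 2).
    by rewrite /b /schur_adj; field.
  by rewrite mulf_neq0 ?invr_neq0.
rewrite -fdet_charfun (fdet_corona _ regG1 x1 x2) -/a -/b.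
rewrite (fdet_add1 c0) => [|u]; last first.
  rewrite sumrB (sum_mulrb u (fun=> a)) -mulr_sumr -degree_sum.
  by rewrite (regG1 u).
rewrite (fdet_adj_eig _ _ regG1) // fdet_charfun_eig //.
have regroup (c N p q s : K) :
    c != 0 -> p * q * (c * s * (1 + N / c)) = q * (c + N) * p * s.
  by move=> c_neq0; field.
exact: regroup.
Qed.

(** The cubic attached to the adjacency eigenvalue [c] of [G1]. *)
Definition corona_cubic (n1 n2 r1 : nat) (c : R) : {poly R} :=
  'X^3 - (n1%:R + n2%:R + 3 + c) *: 'X^2
  + (2 * n2%:R + 3 * n1%:R + 2 * c + 2 - r1%:R) *: 'X
  + (- (2 * n1%:R) + r1%:R - c)%:P.

Lemma corona_cubic_neq0 n1 n2 r1 c : corona_cubic n1 n2 r1 c != 0.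
Proof.
apply/eqP => /(congr1 (fun p : {poly R} => p`_3)); rewrite /corona_cubic.
rewrite !coefD coefN !coefZ !coefXn coefX coefC coef0 /= !mulr0 !addr0 subr0.
by apply/eqP; rewrite oner_eq0.
Qed.

Lemma horner_corona_cubic (G1 G2 : sgraph) (r : nat) (x : K) (c : R) :
  x - 1 != 0 -> x - 2 != 0 ->
  (map_poly phi (corona_cubic #|G1| #|G2| r c)).[x]
    = (x - 1) * (x - 2) * (schur_diag G1 G2 r x - schur_adj x * phi c).
Proof.
rewrite /schur_diag /schur_adj /corona_cubic => x1 x2.
rewrite !(rmorphD, rmorphB, rmorphN) /= !map_polyZ /= !map_polyXn map_polyX !map_polyC.
rewrite !(hornerE, hornerXn) /= !(rmorphD, rmorphN, rmorphM, rmorph_nat, rmorph1) /=.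
move: (#|G1|%:R : K) (#|G2|%:R : K) (r%:R : K) (phi c) => N1 N2 d l.
by field; rewrite x1 x2.
Qed.

(** The hypothesis on [ev] says that [x] is transcendental over [R]. *)
Lemma horner_char_poly_corona_cubic (G1 G2 : sgraph) (r : nat) (x : K)
    (ev := fun p : {poly R} => (map_poly phi p).[x]) :
  (0 < #|G1|)%N -> (0 < #|G2|)%N -> regular G1 r ->
  (forall p : {poly R}, p != 0 -> ev p != 0) ->
  ev (char_poly (lapmx R (central_vertex_corona G1 G2)))
    = ev ('X - 2%:P) ^ (#|edge_set G1|%:Z - #|G1|%:Z)
      * ev ('X^3 - (#|G2|%:R + r%:R + 3) *: 'X^2
            + (r%:R + 2 * #|G2|%:R + 2) *: 'X)
      * ev (\prod_(2 <= j < #|G2|.+1) ('X - 1 - (lap_eig R G2 j)%:P) ^+ #|G1|)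
      * ev (\prod_(2 <= i < #|G1|.+1)
              corona_cubic #|G1| #|G2| r (adj_eig R G1 i)).
Proof.
move=> G1_gt0 G2_gt0 regG1 ev_neq0.
have evXsubC c : ev ('X - c%:P) = x - phi c.
  by rewrite /ev rmorphB /= map_polyX map_polyC hornerXsubC.
have XsubC0 (c : R) : 'X - c%:P != 0 by rewrite polyXsubC_eq0.
have x1 : x - 1 != 0.
  by have := ev_neq0 _ (XsubC0 1); rewrite evXsubC rmorph1.
have x2 : x - 2 != 0.
  by have := ev_neq0 _ (XsubC0 2); rewrite evXsubC rmorph_nat.
set a := schur_diag G1 G2 r x; set b := schur_adj x.
(* (x - 1)(x - 2)(a - b r) is the value at x of the cubic attached to r. *)
have c0 : a - b * r%:R != 0.
  have := ev_neq0 _ (corona_cubic_neq0 #|G1| #|G2| r r%:R).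
  rewrite /ev horner_corona_cubic // rmorph_nat.
  by rewrite mulf_eq0 negb_or => /andP[].
rewrite [LHS](horner_char_poly_corona G1_gt0 G2_gt0 regG1) //.
have -> : ev ('X - 2%:P) = x - 2 by rewrite evXsubC rmorph_nat.
have -> : ev ('X^3 - (#|G2|%:R + r%:R + 3) *: 'X^2
            + (r%:R + 2 * #|G2|%:R + 2) *: 'X)
    = (x - 1) * (x - 2) * (a - b * r%:R + #|G1|%:R).
  rewrite /ev !(rmorphD, rmorphB, rmorphN) /= !map_polyZ /= !map_polyXn map_polyX.
  rewrite !(hornerE, hornerXn) /= !(rmorphD, rmorphN, rmorphM, rmorph_nat, rmorph1) /=.
  rewrite /a /b /schur_diag /schur_adj.
  by move: (#|G1|%:R : K) (#|G2|%:R : K) (r%:R : K) => N1 N2 d; field; rewrite x1 x2.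
have -> : ev (\prod_(2 <= j < #|G2|.+1) ('X - 1 - (lap_eig R G2 j)%:P) ^+ #|G1|)
    = (\prod_(2 <= j < #|G2|.+1) (x - 1 - phi (lap_eig R G2 j))) ^+ #|G1|.
  rewrite /ev prodrXl !rmorphXn horner_exp rmorph_prod horner_prod.
  congr (_ ^+ _); apply: eq_bigr => j _.
  by rewrite !rmorphB rmorph1 /= map_polyX map_polyC !hornerE.
have -> : ev (\prod_(2 <= i < #|G1|.+1)
              corona_cubic #|G1| #|G2| r (adj_eig R G1 i))
    = ((x - 1) * (x - 2)) ^+ #|G1|.-1
      * \prod_(2 <= i < #|G1|.+1) (a - b * phi (adj_eig R G1 i)).
  rewrite /ev rmorph_prod horner_prod.
  rewrite (eq_bigr _ (fun i _ => horner_corona_cubic G1 G2 r (adj_eig R G1 i) x1 x2)).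
  by rewrite big_split prodr_const_nat subSS subn1.
rewrite expfzDr // -exprnN -exprnP.
have regroup n (p q s t y z : K) : y != 0 -> z != 0 ->
    p * t * (y * q) ^+ n.+1 * s
    = p * z ^- n.+1 * (y * z * t) * q ^+ n.+1 * ((y * z) ^+ n * s).
  move=> y0 z0; rewrite !exprMn !exprS.
  have := expf_neq0 n z0; move: (z ^+ n) (y ^+ n) (q ^+ n) => zn yn qn zn0.
  by field; rewrite z0 zn0.
(* Here n is #|G1|.-1, the number of cubics indexed by eigenvalues; only the
   exponents #|G1| are written as n.+1. *)
rewrite -{2 4 6}(prednK G1_gt0).
exact: regroup.
Qed.
End Evaluation.

(** A polynomial, as a rational function, is its own value at ['X]. *)
Lemma tofrac_horner (R : idomainType)
    (phi : {rmorphism R -> {fraction {poly R}}} := (@tofrac {poly R} \o polyC))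
    (p : {poly R}) :
  p%:F = (map_poly phi p).['X%:F].
Proof. by rewrite -[in LHS](comp_polyXr p) /comp_poly -horner_map -map_poly_comp. Qed.

Theorem theorem3p6 (R : rcfType) (G1 G2 : sgraph) (n1 m1 r1 n2 : nat)
    (conn1 : connected G1) (conn2 : connected G2)
    (hn1 : #|G1| = n1) (hm1 : #|edge_set G1| = m1) (hn2 : #|G2| = n2)
    (reg1 : regular G1 r1) :
  (char_poly (lapmx R (central_vertex_corona G1 G2)))%:F =
    ('X - 2%:P)%:F ^ (m1%:Z - n1%:Z)
    * ('X^3 - (n2%:R + r1%:R + 3) *: 'X^2
         + (r1%:R + 2 * n2%:R + 2) *: 'X)%:F
    * (\prod_(2 <= j < n2.+1) ('X - 1 - (lap_eig R G2 j)%:P) ^+ n1)%:F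
    * (\prod_(2 <= i < n1.+1)
         ('X^3 - (n1%:R + n2%:R + 3 + adj_eig R G1 i) *: 'X^2
          + (2 * n2%:R + 3 * n1%:R + 2 * adj_eig R G1 i + 2 - r1%:R) *: 'X
          + (- (2 * n1%:R) + r1%:R - adj_eig R G1 i)%:P))%:F
    :> {fraction {poly R}}.
Proof.
have [G1_gt0 _] := conn1; have [G2_gt0 _] := conn2.
subst n1 n2 m1.
pose phi : {rmorphism R -> {fraction {poly R}}} := @tofrac {poly R} \o polyC.
have ev p : (map_poly phi p).['X%:F] = p%:F by rewrite -tofrac_horner.
have ev_neq0 (p : {poly R}) : p != 0 -> (map_poly phi p).['X%:F] != 0.
  by rewrite ev tofrac_eq0.
have := horner_char_poly_corona_cubic G1_gt0 G2_gt0 reg1 ev_neq0.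
rewrite /= !ev; exact.
Qed.
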